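(* The semi-discretized problem described in the context is unconditionally stable in the sense that for all $\Delta t>0$ (i.e. $\Delta t=T/N_T$ for any integer $N_T\ge1$) its solution $\{u^k\}_{k=0}^{N_T}$ satisfies $$\|u^k\|_1\le\|u^0\|_0+\frac{\kappa}{\zeta_{1,k}}\max_{1\le l\le N_T}\|f^l\|_0,\qquad k=1,2,\dots,N_T .$$
   Context: Let $T,S>0$, $\Lambda=(0,S)$, $n\in\mathbb N$ with $n\ge1$, $0<\alpha_1\le\cdots\le\alpha_n<1$, and $d_i\ge0$ ($i=1,\dots,n$), not all zero. Let $\varphi$ on $\Lambda$ and $f$ on $\Lambda\times[0,T]$ be given sufficiently smooth functions (in particular $\varphi\in L^2(\Lambda)$ and $f(\cdot,t)\in L^2(\Lambda)$). For an integer $N_T\ge1$ put $\Delta t=T/N_T$, $t_k=k\Delta t$, $f^k=f(\cdot,t_k)$. Coefficients: $\sigma_{j,k}^{(\alpha_i)}=\exp\left(-\alpha_i\frac{t_k-t_j}{1-\alpha_i}\right)$ for $0\le j\le k\le N_T$, and for $1\le j\le k\le N_T$ $$b_{j,k}^{(\alpha_i)}=\sigma_{j,k}^{(\alpha_i)}-\sigma_{j-1,k}^{(\alpha_i)},\qquad \eta_{j,k}=\sum_{i=1}^n\frac{d_i}{\alpha_i\Delta t}b_{j,k}^{(\alpha_i)},\qquad \zeta_{j,k}=\frac{\eta_{j,k}}{\eta_{k,k}},\qquad \kappa=\eta_{k,k}^{-1}$$ ($\kappa$ does not depend on $k$, since $b_{k,k}^{(\alpha_i)}=1-\exp(-\alpha_i\Delta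 t/(1-\alpha_i))$). Norms: $(u,v)=\int_\Lambda uv\,\mathrm{d}x$, $\|v\|_0=(v,v)^{1/2}$, and, for $v\in H^1(\Lambda)$, $\|v\|_1=\left(\|v\|_0^2+\kappa\left\|\frac{\mathrm{d}v}{\mathrm{d}x}\right\|_0^2\right)^{1/2}$. Semi-discretized problem: $u^0=\varphi$, and for $k=1,\dots,N_T$ find $u^k\in H_0^1(\Lambda)$ such that for all $v\in H_0^1(\Lambda)$ $$(u^1,v)+\kappa\left(\frac{\partial u^1}{\partial x},\frac{\partial v}{\partial x}\right)=(u^0,v)+\kappa(f^1,v),$$ $$(u^k,v)+\kappa\left(\frac{\partial u^k}{\partial x},\frac{\partial v}{\partial x}\right)=\sum_{j=1}^{k-1}(\zeta_{j+1,k}-\zeta_{j,k})(u^j,v)+\zeta_{1,k}(u^0,v)+\kappa(f^k,v),\quad k\ge2 .$$ *)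

(* Defs.v *)
From HB Require Import structures.
From mathcomp Require Import all_boot all_order all_algebra.
From mathcomp Require Import all_classical all_reals all_analysis.

Set Implicit Arguments.
Unset Strict Implicit.
Unset Printing Implicit Defensive.

Import Order.TTheory GRing.Theory Num.Theory.
Import numFieldNormedType.Exports.

Local Open Scope classical_set_scope.
Local Open Scope ring_scope.

Section Spaces.
Variables (R : realType) (S : R).
Implicit Types (u v g p : R -> R) (kappa : R).

(* Functions on Lambda are represented by functions on R whose values outside
   Lambda are never used. *)
Definition Lambda : set R := `]0, S[.

Definition L2 u : Prop :=
  measurable_fun Lambda u /\
  (@lebesgue_measure R).-integrable Lambda (fun x => (u x ^+ 2)%:E).

Definition inner u v : R :=
  \int[@lebesgue_measure R]_(x in Lambda) (u x * v x).

Definition norm0 v : R := Num.sqrt (inner v v).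

(* C_c^oo(Lambda) *)
Definition test_fun p : Prop :=
  (forall (m : nat) (x : R), derivable (p^`(m))%classic x 1) /\
  exists a b : R, [/\ 0 < a, b < S & forall x, x \notin `[a, b] -> p x = 0].

Definition is_weak_deriv u g : Prop :=
  forall p, test_fun p -> inner u (p^`())%classic = - inner g p.

Definition H1 u : Prop := L2 u /\ exists g, L2 g /\ is_weak_deriv u g.

(* For u in H1, a representative of the weak derivative, which is unique up to
   almost-everywhere equality on Lambda; the zero function otherwise. *)
Definition weak_deriv u : R -> R :=
  xget (fun=> 0) [set g | L2 g /\ is_weak_deriv u g].

Definition norm1 kappa v : R :=
  Num.sqrt (norm0 v ^+ 2 + kappa * norm0 (weak_deriv v) ^+ 2).

(* The closure of C_c^oo(Lambda) in H1; norm1 1 is the usual norm of H1. *)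
Definition H01 u : Prop :=
  H1 u /\
  forall e : R, 0 < e -> exists p, test_fun p /\ norm1 1 (u \- p) < e.

End Spaces.

Section Scheme.
Variables (R : realType) (T : R) (n : nat) (alpha d : 'I_n -> R) (NT : nat).

Definition dt : R := T / NT%:R.

Definition tk (k : nat) : R := k%:R * dt.

Definition sigma (a : R) (j k : nat) : R :=
  expR (- a * ((tk k - tk j) / (1 - a))).

(* used only for 1 <= j, as are eta and zeta *)
Definition bcoef (a : R) (j k : nat) : R := sigma a j k - sigma a j.-1 k.

Definition eta (j k : nat) : R :=
  \sum_(i < n) d i / (alpha i * dt) * bcoef (alpha i) j k.

Definition zeta (j k : nat) : R := eta j k / eta k k.

(* eta k k does not depend on k >= 1, see eta_diag *)
Definition kappa : R := (eta 1 1)^-1.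

Lemma bcoef_diag (a : R) (k : nat) : (1 <= k)%N ->
  bcoef a k k = 1 - expR (- a * (dt / (1 - a))).
Proof.
case: k => // k _; rewrite /bcoef /sigma.
have -> : tk k.+1 - tk k.+1.-1 = dt.
  by rewrite /tk -pred_Sn -natr1 mulrDl mul1r addrAC subrr add0r.
by rewrite subrr mul0r mulr0 expR0.
Qed.

Lemma eta_diag (k : nat) : (1 <= k)%N -> eta k k = eta 1 1.
Proof.
move=> k1; rewrite /eta; apply: eq_bigr => i _.
by rewrite (bcoef_diag _ k1) bcoef_diag.
Qed.

Lemma kappaE (k : nat) : (1 <= k)%N -> kappa = (eta k k)^-1.
Proof. by move=> k1; rewrite /kappa (eta_diag k1). Qed.

Variables (S : R) (phi : R -> R) (f : R -> R -> R).

Definition fk (k : nat) : R -> R := fun x => f x (tk k).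

Definition semidiscrete_solution (u : nat -> R -> R) : Prop :=
  [/\ forall x, Lambda S x -> u 0%N x = phi x,
      forall k, (1 <= k <= NT)%N -> H01 S (u k),
      forall v, H01 S v ->
        inner S (u 1%N) v
          + kappa * inner S (weak_deriv S (u 1%N)) (weak_deriv S v)
        = inner S (u 0%N) v + kappa * inner S (fk 1) v
    & forall k, (2 <= k <= NT)%N -> forall v, H01 S v ->
        inner S (u k) v
          + kappa * inner S (weak_deriv S (u k)) (weak_deriv S v)
        = \sum_(1 <= j < k) (zeta j.+1 k - zeta j k) * inner S (u j) v
          + zeta 1 k * inner S (u 0%N) v + kappa * inner S (fk k) v].

End Scheme.

(* Main.v *)
(* Testing the k-th equation with v = u^k gives ||u^k||_1 ^ 2 on the left.  The
   weights zeta_{j+1,k} - zeta_{j,k} are nonnegative, because sigma_{j,k} is an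
   increasing exponential in j, hence convex, so Cauchy-Schwarz bounds the right
   side by a combination of the ||u^j||_0, ||u^0||_0 and ||f^k||_0 times ||u^k||_0 <=
   ||u^k||_1.  The weights telescope to 1 - zeta_{1,k}, and with
   B = ||u^0||_0 + kappa / zeta_{1,k} max_l ||f^l||_0 one has the exact identity
   (1 - zeta_{1,k}) B + zeta_{1,k} ||u^0||_0 + kappa max_l ||f^l||_0 = B. *)
Require Import Defs.
From HB Require Import structures.
From mathcomp Require Import all_boot all_order all_algebra.
From mathcomp Require Import all_classical all_reals all_analysis.
From mathcomp Require Import ring lra.
Import Order.TTheory GRing.Theory Num.Theory.
Import numFieldNormedType.Exports.
Local Open Scope ring_scope.

Section CauchySchwarz.
Context {d : measure_display} {T : measurableType d} {R : realType}.
Variables (mu : {measure set T -> \bar R}) (D : set T).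
Hypothesis mD : measurable D.
Implicit Types u v : T -> R.

(** The product is dominated pointwise, [|u v| <= u^2 + v^2]. *)
Lemma integrableM_of_sqr u v : measurable_fun D u -> measurable_fun D v ->
  mu.-integrable D (fun x => (u x ^+ 2)%:E) ->
  mu.-integrable D (fun x => (v x ^+ 2)%:E) ->
  mu.-integrable D (fun x => (u x * v x)%:E).
Proof.
move=> mu_ mv iu iv.
apply: (le_integrable mD _ _ (integrableD mD iu iv)).
  by apply/measurable_realfun.measurable_EFinP;
    exact: measurable_realfun.measurable_funM.
move=> x _ /=; rewrite lee_fin normrM.
rewrite [leRHS]ger0_norm ?addr_ge0 ?sqr_ge0//.
rewrite -[u x ^+ 2]real_normK ?num_real// -[v x ^+ 2]real_normK ?num_real//.
by have := normr_ge0 (u x); have := normr_ge0 (v x); nra.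
Qed.

(** Discriminant argument: the integral of [(r u + v)^2] is a quadratic in [r] that never becomes
    negative. *)
Lemma Rintegral_cauchy_schwarz u v :
  mu.-integrable D (fun x => (u x * u x)%:E) ->
  mu.-integrable D (fun x => (u x * v x)%:E) ->
  mu.-integrable D (fun x => (v x * v x)%:E) ->
  (\int[mu]_(x in D) (u x * v x)) ^+ 2 <=
    (\int[mu]_(x in D) (u x * u x)) * (\int[mu]_(x in D) (v x * v x)).
Proof.
move=> iuu iuv ivv.
set a := (X in _ <= X * _); set c := (X in _ <= _ * X).
set b := (X in X ^+ 2).
have quad r : 0 <= a * r ^+ 2 + 2 * b * r + c.
  have iruu : mu.-integrable D (EFin \o (fun x => r ^+ 2 * (u x * u x))).
    exact: (integrableZl mD (r ^+ 2) iuu).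
  have iruv : mu.-integrable D (EFin \o (fun x => 2 * r * (u x * v x))).
    exact: (integrableZl mD (2 * r) iuv).
  have -> : a * r ^+ 2 + 2 * b * r + c =
      \int[mu]_(x in D) ((r * u x + v x) ^+ 2).
    have -> : a * r ^+ 2 + 2 * b * r + c = r ^+ 2 * a + 2 * r * b + c by ring.
    rewrite /a /b /c -RintegralZl// -RintegralZl// -RintegralD// -RintegralD//.
      by apply: eq_Rintegral => x _; ring.
    exact: (integrableD mD iruu iruv).
  by apply: Rintegral_ge0 => x _; exact: sqr_ge0.
(* Only [size p <= 3] is required, so a vanishing leading coefficient [a] needs no separate case. *)
pose p := Poly [:: c; 2 * b; a].
have pge0 r : 0 <= p.[r].
  by rewrite horner_Poly /=; have := quad r; nra.
have := deg_le2_poly_ge0 (size_Poly _ : (size p <= 3)%N) pge0.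
by rewrite !coef_Poly /=; nra.
Qed.

End CauchySchwarz.

Section InnerProduct.
Context {R : realType}.
Variable S : R.
Implicit Types u v w : R -> R.

Lemma eq_inner u w v : (forall x, Lambda S x -> u x = w x) ->
  inner S u v = inner S w v.
Proof.
by move=> uw; apply: eq_Rintegral => x /set_mem Sx; rewrite uw.
Qed.

Lemma eq_norm0 u w : (forall x, Lambda S x -> u x = w x) ->
  norm0 S u = norm0 S w.
Proof.
move=> uw; congr Num.sqrt.
by apply: eq_Rintegral => x /set_mem Sx; rewrite uw.
Qed.

Lemma norm0_sqr u : norm0 S u ^+ 2 = inner S u u.
Proof.
rewrite sqr_sqrtr//; apply: Rintegral_ge0 => x _.
by rewrite -expr2 sqr_ge0.
Qed.

Lemma inner_le_norm0 u v : L2 S u -> L2 S v ->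
  inner S u v <= norm0 S u * norm0 S v.
Proof.
move=> [mu iu] [mv iv].
(* [lebesgue_measure] lives on [measurableTypeR R], whose display is not that of
   the canonical measurable structure of R in which [L2] states measurability. *)
have mS : @measurable _ (measurableTypeR R) (Lambda S) by exact: measurable_itv.
have iM :=
  @integrableM_of_sqr _ (measurableTypeR R) _ (@lebesgue_measure R) _ mS.
have iuv := iM _ _ mu mv iu iv.
have iuu := iM _ _ mu mu iu iu.
have ivv := iM _ _ mv mv iv iv.
apply: le_trans (ler_norm _) _.
rewrite -(@ler_pXn2r _ 2) ?nnegrE ?mulr_ge0 ?sqrtr_ge0//.
rewrite real_normK ?num_real// exprMn (norm0_sqr u) (norm0_sqr v).
exact: (@Rintegral_cauchy_schwarz _ (measurableTypeR R) _
  (@lebesgue_measure R) _ mS).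
Qed.

Lemma norm1_ge0 kappa u : 0 <= norm1 S kappa u.
Proof. exact: sqrtr_ge0. Qed.

Lemma norm1_sqr kappa u : 0 <= kappa ->
  norm1 S kappa u ^+ 2 =
    inner S u u + kappa * inner S (weak_deriv S u) (weak_deriv S u).
Proof.
move=> k0; rewrite -!norm0_sqr sqr_sqrtr//.
by rewrite addr_ge0 ?sqr_ge0// mulr_ge0 ?sqr_ge0.
Qed.

Lemma norm0_le_norm1 kappa u : 0 <= kappa -> norm0 S u <= norm1 S kappa u.
Proof.
move=> k0; rewrite -(@ler_pXn2r _ 2) ?nnegrE ?sqrtr_ge0//.
by rewrite norm1_sqr// norm0_sqr lerDl mulr_ge0// -norm0_sqr sqr_ge0.
Qed.

End InnerProduct.

Section Coefficients.
Context {R : realType} (T : R) (n : nat) (alpha d : 'I_n -> R) (NT : nat).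
Hypotheses (hT : 0 < T) (hNT : (1 <= NT)%N)
  (halpha : forall i, 0 < alpha i < 1)
  (hd : forall i, 0 <= d i) (hd_neq0 : exists i, d i != 0).

Let tau := dt T NT.
Let rate (a : R) := a / (1 - a).

Lemma dt_gt0 : 0 < dt T NT.
Proof. by rewrite divr_gt0 ?ltr0n. Qed.

(** The factor [expR (rate a * tau) - 1] is free of [j] and [k], so sign and monotonicity of the
    coefficients can be read off a single exponential. *)
Lemma bcoefE a j k : bcoef T NT a j.+1 k =
  expR (rate a * tk T NT j - rate a * tk T NT k) * (expR (rate a * tau) - 1).
Proof.
rewrite /bcoef /sigma mulrBr mulr1 -expRD /=.
congr (expR _ - expR _); rewrite /rate /tk -/tau -?natr1; ring.
Qed.

Lemma expR_rate_sub1_gt0 i : 0 < expR (rate (alpha i) * tau) - 1.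
Proof.
case/andP: (halpha i) => a0 a1.
by rewrite subr_gt0 expR_gt1 mulr_gt0 ?dt_gt0// divr_gt0 ?subr_gt0.
Qed.

Lemma bcoef_gt0 i j k : 0 < bcoef T NT (alpha i) j.+1 k.
Proof. by rewrite bcoefE mulr_gt0 ?expR_gt0 ?expR_rate_sub1_gt0. Qed.

(** Growth in [j] is the discrete convexity of [sigma] and makes the scheme's weights nonnegative;
    decay in [k] serves to compare [zeta 1 k] across time steps. *)
Lemma bcoef_le i j j' k k' : (j <= j')%N -> (k' <= k)%N ->
  bcoef T NT (alpha i) j.+1 k <= bcoef T NT (alpha i) j'.+1 k'.
Proof.
move=> jj' kk'; rewrite !bcoefE ler_pM2r ?expR_rate_sub1_gt0// ler_expR.
have rate0 : 0 <= rate (alpha i).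
  by case/andP: (halpha i) => a0 a1; rewrite divr_ge0 ?ltW// subr_gt0.
have tk_le m m' : (m <= m')%N -> tk T NT m <= tk T NT m'.
  by move=> mm'; rewrite ler_wpM2r ?ler_nat// ltW ?dt_gt0.
by rewrite lerB// ler_wpM2l// tk_le.
Qed.

Lemma weight_ge0 i : 0 <= d i / (alpha i * dt T NT).
Proof.
by case/andP: (halpha i) => a0 _; rewrite divr_ge0// ltW// mulr_gt0 ?dt_gt0.
Qed.

Lemma eta_gt0 j k : 0 < Defs.eta T alpha d NT j.+1 k.
Proof.
(* One index with [d i != 0] gives a strictly positive term; the others are nonnegative. *)
case: hd_neq0 => i di0; rewrite /Defs.eta (bigD1 i)//=.
case/andP: (halpha i) => a0 _.
rewrite ltr_wpDr//.
  by apply: sumr_ge0 => l _; rewrite mulr_ge0 ?weight_ge0// ltW ?bcoef_gt0.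
have di_gt0 : 0 < d i by rewrite lt0r di0 hd.
by rewrite mulr_gt0 ?bcoef_gt0// divr_gt0// mulr_gt0 ?dt_gt0.
Qed.

Lemma eta_le j j' k k' : (j <= j')%N -> (k' <= k)%N ->
  Defs.eta T alpha d NT j.+1 k <= Defs.eta T alpha d NT j'.+1 k'.
Proof.
move=> jj' kk'; apply: ler_sum => i _.
by rewrite ler_wpM2l ?weight_ge0 ?bcoef_le.
Qed.

Lemma kappa_gt0 : 0 < kappa T alpha d NT.
Proof. by rewrite invr_gt0 eta_gt0. Qed.

Lemma zeta_gt0 j k : 0 < zeta T alpha d NT j.+1 k.+1.
Proof. by rewrite divr_gt0 ?eta_gt0. Qed.

Lemma zeta_leS j k :
  zeta T alpha d NT j.+1 k.+1 <= zeta T alpha d NT j.+2 k.+1.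
Proof. by rewrite ler_pM2r ?invr_gt0 ?eta_gt0// eta_le. Qed.

Lemma zeta1_le k k' : (k' <= k)%N ->
  zeta T alpha d NT 1 k.+1 <= zeta T alpha d NT 1 k'.+1.
Proof.
(* The diagonal denominators coincide, so only the numerators [eta 1 _] are compared. *)
move=> kk'; rewrite /zeta !eta_diag// ler_pM2r ?invr_gt0 ?eta_gt0//.
exact: eta_le.
Qed.

Lemma zeta_diag k : zeta T alpha d NT k.+1 k.+1 = 1.
Proof. by rewrite /zeta divff// gt_eqF ?eta_gt0. Qed.

End Coefficients.

Theorem theorem2p2 (R : realType) (T S : R) (n : nat)
    (alpha d : 'I_n -> R) (phi : R -> R) (f : R -> R -> R)
    (hT : 0 < T) (hS : 0 < S) (hn : (1 <= n)%N)
    (halpha : forall i, 0 < alpha i < 1)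
    (halpha_mono : forall i j : 'I_n, (i <= j)%N -> alpha i <= alpha j)
    (hd : forall i, 0 <= d i) (hd_neq0 : exists i, d i != 0)
    (hphi : L2 S phi)
    (hf : forall t, 0 <= t <= T -> L2 S (fun x => f x t))
    (NT : nat) (hNT : (1 <= NT)%N) (u : nat -> R -> R)
    (hu : semidiscrete_solution T alpha d NT S phi f u)
    (k : nat) (hk : (1 <= k <= NT)%N) :
  norm1 S (kappa T alpha d NT) (u k) <=
    norm0 S (u 0%N)
    + kappa T alpha d NT / zeta T alpha d NT 1 k
      * \big[Order.max/0]_(1 <= l < NT.+1) norm0 S (fk T NT f l).
Proof.
case: hu => u0E uH u1E ukE.
set M := \big[_/_]_(_ <= _ < _) _; set K := kappa _ _ _ _.
set Z := zeta T alpha d NT; set U := norm0 S (u 0%N).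
have K0 : 0 < K by exact: kappa_gt0.
have Zgt0 j m : 0 < Z j.+1 m.+1 by exact: zeta_gt0.
have M0 : 0 <= M by exact: bigmax_ge_id.
have L2u m : (1 <= m <= NT)%N -> L2 S (u m) by move=> /uH[[]].
have L2f m : (1 <= m <= NT)%N -> L2 S (fk T NT f m).
  case/andP=> _ mNT; apply: hf; apply/andP; split.
    by rewrite mulr_ge0// ltW// dt_gt0.
  by rewrite /tk /dt mulrCA ger_pMr// ler_pdivrMr ?ltr0n// mul1r ler_nat.
have fM m : (1 <= m <= NT)%N -> norm0 S (fk T NT f m) <= M.
  move=> mN; rewrite /M; apply: (le_bigmax_seq 0 m xpredT) => //.
  by rewrite mem_index_iota.
(* [u 0] is known only to agree with [phi] on [Lambda], which is all that [inner] and [norm0] see;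
   square integrability is taken from [phi]. *)
have u0_le v : L2 S v -> inner S (u 0%N) v <= U * norm0 S v.
  move=> Lv; rewrite (eq_inner _ _ _ _ u0E) /U (eq_norm0 _ _ _ u0E).
  exact: inner_le_norm0.
(* Strong induction works because zeta_{1,k} decreases in k, so that the bounds
   on the earlier u^j are all at most B. *)
elim/ltn_ind: k hk => k IH hk.
pose B := U + K / Z 1%N k * M.
case: k => // k in IH hk B *.
have energy : norm1 S K (u k.+1) ^+ 2 <=
   (\sum_(1 <= j < k.+1) (Z j.+1 k.+1 - Z j k.+1) * norm0 S (u j)
     + Z 1%N k.+1 * U + K * norm0 S (fk T NT f k.+1)) * norm0 S (u k.+1).
  have uf : inner S (fk T NT f k.+1) (u k.+1) <=
      norm0 S (fk T NT f k.+1) * norm0 S (u k.+1).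
    by apply: inner_le_norm0; [exact: L2f | exact: L2u].
  rewrite norm1_sqr; last exact: ltW.
  (* The first equation has the general form too: its history sum is empty and [Z 1 1 = 1]. *)
  case: k => [|k] in IH hk B uf *.
    rewrite (u1E _ (uH _ hk)) big_geq// add0r /Z zeta_diag// mul1r mulrDl.
    by rewrite -mulrA lerD// ?ler_pM2l// u0_le//; exact: L2u.
  rewrite (ukE k.+2 hk _ (uH _ hk)) 2!mulrDl lerD//; last by rewrite -mulrA ler_pM2l.
  rewrite lerD//; last by rewrite -mulrA ler_pM2l// u0_le//; exact: L2u.
  rewrite mulr_suml !big_nat ler_sum// => j /andP[j1 jk].
  rewrite -mulrA ler_wpM2l//; last first.
    apply: inner_le_norm0; apply: L2u => //; rewrite j1 /=.
    by case/andP: hk => _; apply: leq_trans; exact: ltnW.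
  by case: j j1 jk => // j _ _; rewrite subr_ge0 zeta_leS.
have bound : \sum_(1 <= j < k.+1) (Z j.+1 k.+1 - Z j k.+1) * norm0 S (u j)
     + Z 1%N k.+1 * U + K * norm0 S (fk T NT f k.+1) <= B.
  apply: (@le_trans _ _ ((\sum_(1 <= j < k.+1) (Z j.+1 k.+1 - Z j k.+1)) * B
     + Z 1%N k.+1 * U + K * M)).
    rewrite lerD ?ler_pM2l ?fM// lerD// mulr_suml !big_nat ler_sum//.
    case=> // j /andP[_ jk].
    rewrite ler_wpM2l ?subr_ge0 ?zeta_leS//.
    (* The sum contains [norm0], while [IH] bounds the larger [norm1], with [Z 1 j.+1] in the
       denominator; the smaller [Z 1 k.+1] only enlarges that bound. *)
    apply: (le_trans (norm0_le_norm1 _ _ _ (ltW K0))).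
    have jN : (1 <= j.+1 <= NT)%N.
      by case/andP: hk => _; apply: leq_trans; exact: ltnW.
    apply: (le_trans (IH j.+1 jk jN)).
    rewrite lerD2l ler_wpM2r// ler_pM2l// lef_pV2 ?posrE//.
    by apply: zeta1_le => //; exact: ltnW.
  rewrite (telescope_sumr (fun j => Z j k.+1))// {1}/Z zeta_diag//.
  rewrite le_eqVlt; apply/orP; left; apply/eqP; rewrite /B; field.
  by rewrite gt_eqF.
(* One factor [norm1] is to be cancelled, so the case where it vanishes is settled first. *)
have := norm1_ge0 S K (u k.+1); rewrite le_eqVlt => /predU1P[<-|n1].
  by rewrite addr_ge0 ?sqrtr_ge0// mulr_ge0// divr_ge0// ltW.
rewrite -(ler_pM2r n1) -expr2; apply: (le_trans energy).
(* The sign of [B] allows [norm0] to be replaced by [norm1] in the remaining factor. *)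
have B0 : 0 <= B by rewrite addr_ge0 ?sqrtr_ge0// mulr_ge0// divr_ge0// ltW.
apply: (@le_trans _ _ (B * norm0 S (u k.+1))).
  by rewrite ler_wpM2r// sqrtr_ge0.
by rewrite ler_wpM2l// norm0_le_norm1// ltW.
Qed.
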